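(* Let $B$ be a bouquet, let $I(B)$ be its intersection graph and let $L_{I(B)}\subseteq E(B)$ be the set of non-orientable loops of $B$. Then for every $\bullet\in\{\delta,\tau,\delta\tau,\tau\delta,\tau\delta\tau\}$, \[ {}^{\partial}\varepsilon^{\bullet}_{B}(z)=P^{\langle\bullet\rangle}_{(I(B),L_{I(B)})}(z). \]
   Context: A ribbon graph $G$ is a surface with boundary represented as a union of vertex discs $V(G)$ and edge discs $E(G)$ such that vertices and edges meet in disjoint line segments, each lying on the boundary of exactly one vertex and one edge, and each edge contains exactly two such segments. For a ribbon graph $G$, $v(G),e(G),f(G),c(G)$ denote the numbers of vertices, edges, boundary components and connected components; the Euler genus is $\varepsilon(G)=2c(G)-v(G)+e(G)-f(G)$. For $A\subseteq E(G)$, the spanning ribbon subgraph $(V(G),A)$ is obtained by deleting the edges not in $A$. The partial dual $G^{\delta(A)}$ is obtained by gluing a disc along each boundary component of $(V(G),A)$ (these become the vertices), removing the interiors of the original vertex discs, and keeping the edge ribbons. The partial Petrial $G^{\tau(A)}$ is obtained by adding a half-twist to each edge in $A$. For a word $w=w_1\cdots w_n$ over $\{\delta,\tau\}$, $G^{w(A)}:=(\cdots(G^{w_n(A)})^{w_{n-1}(A)}\cdots)^{w_1(A)}$. For $\bullet\in\{\delta,\tau,\delta\tau,\tau\delta,\tau\delta\tau\}$ the partial-$\bullet$ polynomial of $G$ is ${}^{\partial}\varepsilon^{\bullet}_{G}(z)=\sum_{A\subseteq E(G)} z^{\varepsilon(G^{\bullet(A)})}$. A bouquet is a ribbon graph with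 exactly one vertex. A loop $e$ at vertex $v$ is non-orientable if $e\cup v$ is a Möbius band. Two loops are interlaced if their ends alternate along the boundary of the vertex. The intersection graph $I(B)$ of a bouquet $B$ is the simple graph on vertex set $E(B)$ with two vertices adjacent iff the corresponding loops are interlaced. A graft $(G,L_G)$ is a simple graph $G$ with a subset $L_G\subseteq V(G)$; its adjacency matrix $\mathbf A_{(G,L_G)}$ is the $V(G)\times V(G)$ matrix over $\mathrm{GF}(2)$ with $(u,v)$-entry $1$ iff ($u\ne v$ and $u,v$ adjacent) or ($u=v\in L_G$), and $0$ otherwise. For a square matrix $M$ over a field with rows and columns indexed by a finite set $V$, and $A\subseteq V$: $M[A]$ is the principal submatrix on $A$, $A^c=V\setminus A$, $I_A$ is the diagonal matrix with $(I_A)_{ii}=1$ for $i\in A$ and $0$ otherwise, and $\operatorname{corank}$ of a square matrix is its size minus its rank (empty matrices have rank $0$). Define $r_{\langle\delta\rangle}(M,A)=\operatorname{rank}(M[A])+\operatorname{rank}(M[A^c])$, $r_{\langle\tau\rangle}(M,A)=\operatorname{rank}(M+I_A)$, $r_{\langle\delta\tau\rangle}(M,A)=\operatorname{rank}((M+I_A)[A])+\operatorname{rank}(M[A^c])$, $r_{\langle\tau\delta\rangle}(M,A)=\operatorname{rank}(M+I_A)-\operatorname{corank}(M[A])$, $r_{\langle\tau\delta\tau\rangle}(M,A)=\operatorname{rank}(M)-\operatorname{corank}((M+I_A)[A])$, and $P_{\langle\bullet\rangle}(M,z)=\sum_{A\subseteq V} z^{r_{\langle\bullet\rangle}(M,A)}$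 (equal to $1$ for the empty matrix). For a graft, $P^{\langle\bullet\rangle}_{(G,L_G)}(z):=P_{\langle\bullet\rangle}(\mathbf A_{(G,L_G)},z)$. *)

(* Defs.v *)
From HB Require Import structures.
From mathcomp Require Import all_boot all_order all_algebra.

Set Implicit Arguments.
Unset Strict Implicit.
Unset Printing Implicit Defensive.

Import GRing.Theory.

(** * Ribbon graphs

    An edge disc meets the vertices in two disjoint segments, so its boundary
    is a rectangle with four corners.  A ribbon graph with edge set [E] is
    determined, up to homeomorphism, by its corners, by the three ways of
    moving along the boundary curves from a corner to a neighbouring one, and
    by the number of vertices that meet no edge:
    - [seg x] is the other end of the vertex-edge segment ending at [x];
    - [side x] is the other end of the free side of the ribbon ending at [x];
    - [arc x] is the other end of the arc of vertex boundary that leaves the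
      ribbon at [x] and runs to the next ribbon around the vertex. *)
Record ribbonGraph (E : finType) := RibbonGraph {
  corner : finType;
  edge_of : corner -> E;
  seg : corner -> corner;
  side : corner -> corner;
  arc : corner -> corner;
  isolated : nat;
  segK : involutive seg;
  sideK : involutive side;
  arcK : involutive arc;
  seg_neq : forall x, seg x != x;
  side_neq : forall x, side x != x;
  arc_neq : forall x, arc x != x;
  seg_sideC : forall x, seg (side x) = side (seg x);
  seg_side_neq : forall x, seg (side x) != x;
  edge_seg : forall x, edge_of (seg x) = edge_of x;
  edge_side : forall x, edge_of (side x) = edge_of x;
  edge_card : forall e, #|[set x | edge_of x == e]| = 4
}.

Definition orbit_count (C : finType) (fs : seq (C -> C)) : nat :=
  n_comp [rel x y | has (fun f : C -> C => f x == y) fs] C.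

Section Invariants.
Variables (E : finType) (G : ribbonGraph E).

(** A vertex meeting no edge carries no corner; it accounts for one vertex,
    one boundary component and one connected component. *)
Definition num_vertices : nat :=
  orbit_count [:: @seg E G; @arc E G] + isolated G.
Definition num_edges : nat := #|E|.
Definition num_faces : nat :=
  orbit_count [:: @side E G; @arc E G] + isolated G.
Definition num_components : nat :=
  orbit_count [:: @seg E G; @side E G; @arc E G] + isolated G.

Definition euler_genus : int :=
  (2 * num_components%:Z - num_vertices%:Z + num_edges%:Z - num_faces%:Z)%R.

Definition bouquet : Prop := num_vertices = 1.

End Invariants.

(** * Partial duals and partial Petrials *)

Section PartialDual.
Variables (E : finType) (A : {set E}) (G : ribbonGraph E).
Implicit Type x : corner G.

(** The boundary of the spanning ribbon subgraph [(V(G), A)] follows the free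
    sides of the edges in [A] and the vertex segments of the edges not in [A].
    It becomes the vertex boundary of the partial dual, so these are the new
    vertex-edge segments; the other two sides of each ribbon become free. *)
Definition dual_seg x := if edge_of x \in A then side x else seg x.
Definition dual_side x := if edge_of x \in A then seg x else side x.

Lemma dual_edge_seg x : edge_of (dual_seg x) = edge_of x.
Proof. by rewrite /dual_seg; case: ifP; rewrite ?edge_seg ?edge_side. Qed.

Lemma dual_edge_side x : edge_of (dual_side x) = edge_of x.
Proof. by rewrite /dual_side; case: ifP; rewrite ?edge_seg ?edge_side. Qed.

Lemma dual_segK : involutive dual_seg.
Proof.
move=> x; move: (dual_edge_seg x); rewrite /dual_seg.
by case xA: (edge_of x \in A) => ->; rewrite xA ?segK ?sideK.
Qed.

Lemma dual_sideK : involutive dual_side.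
Proof.
move=> x; move: (dual_edge_side x); rewrite /dual_side.
by case xA: (edge_of x \in A) => ->; rewrite xA ?segK ?sideK.
Qed.

Lemma dual_seg_neq x : dual_seg x != x.
Proof. by rewrite /dual_seg; case: ifP; rewrite ?seg_neq ?side_neq. Qed.

Lemma dual_side_neq x : dual_side x != x.
Proof. by rewrite /dual_side; case: ifP; rewrite ?seg_neq ?side_neq. Qed.

Lemma dual_seg_sideC x : dual_seg (dual_side x) = dual_side (dual_seg x).
Proof.
move: (dual_edge_seg x) (dual_edge_side x); rewrite /dual_seg /dual_side.
by case xA: (edge_of x \in A) => -> ->; rewrite xA ?seg_sideC.
Qed.

Lemma dual_seg_side_neq x : dual_seg (dual_side x) != x.
Proof.
move: (dual_edge_side x); rewrite /dual_seg /dual_side.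
by case xA: (edge_of x \in A) => ->; rewrite xA -?seg_sideC seg_side_neq.
Qed.

Definition partial_dual : ribbonGraph E :=
  @RibbonGraph E (corner G) (@edge_of E G) dual_seg dual_side (@arc E G)
    (isolated G) dual_segK dual_sideK (@arcK E G) dual_seg_neq dual_side_neq
    (@arc_neq E G) dual_seg_sideC dual_seg_side_neq dual_edge_seg
    dual_edge_side (@edge_card E G).

(** After a half-twist each free side of the ribbon runs to the opposite
    corner. *)
Definition petrial_side x := if edge_of x \in A then seg (side x) else side x.

Lemma petrial_edge_side x : edge_of (petrial_side x) = edge_of x.
Proof. by rewrite /petrial_side; case: ifP; rewrite ?edge_seg ?edge_side. Qed.

Lemma petrial_sideK : involutive petrial_side.
Proof.
move=> x; move: (petrial_edge_side x); rewrite /petrial_side.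
by case xA: (edge_of x \in A) => ->; rewrite xA ?sideK // -seg_sideC segK sideK.
Qed.

Lemma petrial_side_neq x : petrial_side x != x.
Proof.
by rewrite /petrial_side; case: ifP; rewrite ?seg_side_neq ?side_neq.
Qed.

Lemma petrial_seg_sideC x : seg (petrial_side x) = petrial_side (seg x).
Proof.
by rewrite /petrial_side edge_seg; case: ifP; rewrite !seg_sideC.
Qed.

Lemma petrial_seg_side_neq x : seg (petrial_side x) != x.
Proof.
by rewrite /petrial_side; case: ifP; rewrite ?segK ?side_neq ?seg_side_neq.
Qed.

Definition partial_petrial : ribbonGraph E :=
  @RibbonGraph E (corner G) (@edge_of E G) (@seg E G) petrial_side (@arc E G)
    (isolated G) (@segK E G) petrial_sideK (@arcK E G) (@seg_neq E G)
    petrial_side_neq (@arc_neq E G) petrial_seg_sideC petrial_seg_side_neq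
    (@edge_seg E G) petrial_edge_side (@edge_card E G).

End PartialDual.

Inductive letter := Delta | Tau.

Definition apply_letter (E : finType) (A : {set E}) (l : letter)
    (G : ribbonGraph E) : ribbonGraph E :=
  match l with
  | Delta => partial_dual A G
  | Tau => partial_petrial A G
  end.

(** The last letter of the word acts first. *)
Definition apply_word (E : finType) (w : seq letter) (A : {set E})
    (G : ribbonGraph E) : ribbonGraph E :=
  foldr (apply_letter A) G w.

Inductive bullet := B_delta | B_tau | B_delta_tau | B_tau_delta | B_tau_delta_tau.

Definition word_of (b : bullet) : seq letter :=
  match b with
  | B_delta => [:: Delta]
  | B_tau => [:: Tau]
  | B_delta_tau => [:: Delta; Tau]
  | B_tau_delta => [:: Tau; Delta]
  | B_tau_delta_tau => [:: Tau; Delta; Tau]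
  end.

(** The Euler genus of a ribbon graph is nonnegative, so the absolute value
    below is only a cast from [int] to [nat]. *)
Definition partial_poly (b : bullet) (E : finType) (G : ribbonGraph E) :
    {poly int} :=
  (\sum_(A : {set E}) 'X^(`|euler_genus (apply_word (word_of b) A G)|%N))%R.

(** * Grafts *)

Record simpleGraph (V : finType) := SimpleGraph {
  adj : rel V;
  adj_sym : symmetric adj;
  adj_irrefl : irreflexive adj
}.

Record graft (V : finType) := Graft {
  graft_graph : simpleGraph V;
  graft_set : {set V}
}.

(** The vertex set [V] is listed by [enum_val : 'I_#|V| -> V]. *)
Definition graft_mx (V : finType) (H : graft V) : 'M['F_2]_#|V| :=
  (\matrix_(i, j)
    ((i != j) && adj (graft_graph H) (enum_val i) (enum_val j)
     || (i == j) && (enum_val i \in graft_set H))%:R)%R.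

(** * Rank polynomials of a square matrix *)

Section RankPolynomial.
Variables (F : fieldType) (n : nat).
Implicit Types (M : 'M[F]_n) (A : {set 'I_n}).

Definition principal M A : 'M[F]_#|A| := mxsub enum_val enum_val M.

Definition diag_ind A : 'M[F]_n := diag_mx (\row_i (i \in A)%:R)%R.

Definition corank m (N : 'M[F]_m) : nat := m - \rank N.

(** The truncated subtractions lose nothing: a kernel vector [x] of [M[A]],
    extended by [0], is mapped by [M + I_A] to a vector agreeing with [x] on
    [A], so [corank M[A] <= rank (M + I_A)]; similarly, [M] acts as [-1] on
    the kernel of [(M + I_A)[A]]. *)
Definition rank_fun (b : bullet) M A : nat :=
  match b with
  | B_delta => \rank (principal M A) + \rank (principal M (~: A))
  | B_tau => \rank (M + diag_ind A)%R
  | B_delta_tau => \rank (principal (M + diag_ind A)%R A)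
            + \rank (principal M (~: A))
  | B_tau_delta => \rank (M + diag_ind A)%R - corank (principal M A)
  | B_tau_delta_tau => \rank M - corank (principal (M + diag_ind A)%R A)
  end.

Definition rank_poly (b : bullet) M : {poly int} :=
  (\sum_(A : {set 'I_n}) 'X^(rank_fun b M A))%R.

End RankPolynomial.

Definition graft_poly (b : bullet) (V : finType) (H : graft V) : {poly int} :=
  rank_poly b (graft_mx H).

(** * The graft of a bouquet *)

Section IntersectionGraph.
Variables (E : finType) (B : ribbonGraph E).

(** A surface is orientable iff its corners can be 2-coloured so that each of
    the three moves changes the colour.  Below only the ribbon [e] is glued to
    the vertex discs, so only its free sides impose a condition; a vertex disc
    with one ribbon attached is a Moebius band iff it is not orientable. *)
Definition nonorientable_loop (e : E) : bool :=
  ~~ [exists s : {ffun corner B -> bool},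
        [forall x, [&& s (seg x) != s x, s (arc x) != s x
                     & (edge_of x == e) ==> (s (side x) != s x)]]].

(** One step along the vertex boundary: along the segment from [x], then along
    the arc to the next segment.  The orbit of [x] meets each segment of its
    vertex exactly once, in cyclic order. *)
Definition next_end (x : corner B) : corner B := arc (seg x).

Definition ends_word (x : corner B) (e f : E) : seq E :=
  [seq g <- [seq edge_of y | y <- orbit next_end x] | g \in [:: e; f]].

Definition interlaced : rel E := fun e f =>
  (e != f) &&
  [exists x, (ends_word x e f == [:: e; f; e; f])
          || (ends_word x e f == [:: f; e; f; e])].

Lemma ends_wordC x e f : ends_word x e f = ends_word x f e.
Proof. by apply: eq_filter => g; rewrite !inE orbC. Qed.

Lemma interlaced_sym : symmetric interlaced.
Proof.
move=> e f; rewrite /interlaced eq_sym; congr (_ && _).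
by apply: eq_existsb => x; rewrite orbC ends_wordC.
Qed.

Lemma interlaced_irrefl : irreflexive interlaced.
Proof. by move=> e; rewrite /interlaced eqxx. Qed.

Definition intersection_graph : simpleGraph E :=
  SimpleGraph interlaced_sym interlaced_irrefl.

Definition intersection_graft : graft E :=
  Graft intersection_graph [set e | nonorientable_loop e].

End IntersectionGraph.

(* Main.v *)
Require Import Defs.
From mathcomp Require Import all_boot all_order all_algebra.
From mathcomp Require Import mxabelem fingraph zify.

(** Keeping, twisting or deleting each ribbon of a bouquet [B] gives a surface
    whose boundary components are the orbits of [arc] and of the move [bd] that
    is [side], [seg \o side] or [seg] on the corners of that ribbon.  The vertex
    and face counts in the genus of every partial dual or Petrial of [B] are of
    this form, so it suffices to show that, if [S] is the set of ribbons that
    are not deleted and [T] the set of twisted ones, the number of orbits is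
    [corank ((M + I_T)[S]) + 1], with [M] the adjacency matrix of the graft.

    There are [2 ^ k] functions to GF(2) invariant under the moves, [k] being
    the number of orbits.  An arc-invariant function is determined up to a
    constant by its jumps across the vertex segments; invariance under [bd]
    forces the two segments of an edge [e] to have the same jump [a_e].  Going
    around the vertex from [x] to [side x], with [x] on [e], one crosses one
    segment of each loop interlaced with [e], zero or two of the other loops,
    and one of [e] itself iff [e] is non-orientable, so the function changes by
    [(M a)_e].  Hence invariance means that [a] vanishes outside [S] and that
    [(M + I_T) a] vanishes on [S]. *)

Set Implicit Arguments.
Unset Strict Implicit.
Unset Printing Implicit Defensive.

Import GRing.Theory.

(** * Arithmetic over GF(2) and functions constant on components *)

Lemma F2_addrr (a : 'F_2) : (a + a = 0)%R.
Proof. exact: addrr_pchar2 (pchar_Fp (isT : prime 2)) a. Qed.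

Lemma F2_addKr (a : 'F_2) : involutive (+%R a).
Proof. exact: addKr_pchar2 (pchar_Fp (isT : prime 2)) a. Qed.

Lemma F2_natr_addb (a b : bool) : ((a (+) b)%:R = a%:R + b%:R :> 'F_2)%R.
Proof. by case: a; case: b; rewrite ?F2_addrr ?addr0 ?add0r. Qed.

Lemma graft_mx_sym (V : finType) (K : graft V) :
  ((graft_mx K)^T = graft_mx K)%R.
Proof.
apply/matrixP=> i j; rewrite !mxE eq_sym adj_sym.
by case: eqP => [->|].
Qed.

(** Such a function amounts to a free choice of one value per component, made at its [root]; [lift]
    spreads the choices over the components. *)
Lemma card_component_functions (C : finType) (e : rel C) : symmetric e ->
  #|[set h : {ffun C -> 'F_2} | [forall x, forall y, e x y ==> (h x == h y)]]|
  = 2 ^ n_comp e C.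
Proof.
move=> e_sym; have csym := sym_connect_sym e_sym.
pose K := {x | roots e x}.
pose lift (g : {ffun K -> 'F_2}) : {ffun C -> 'F_2} :=
  [ffun x => g (exist _ (root e x) (roots_root csym x))].
have lift_inj : injective lift.
  move=> g1 g2 /ffunP eq_g; apply/ffunP=> -[x rx].
  have eqx : exist _ (root e x) (roots_root csym x) = exist _ x rx :> K.
    by apply: val_inj => /=; apply/eqP.
  by have := eq_g x; rewrite !ffunE eqx.
have -> : [set h : {ffun C -> 'F_2} |
    [forall x, forall y, e x y ==> (h x == h y)]] = lift @: setT.
  apply/setP=> h; rewrite inE; apply/idP/imsetP => [hP | [g _ ->]].
    exists [ffun u => h (sval u)] => //; apply/ffunP=> x; rewrite !ffunE /=.
    have clx : closed e [pred y | h x == h y].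
      move=> y z /= yz; move/forallP/(_ y)/forallP/(_ z): hP.
      by rewrite yz !inE => /= /eqP->.
    have := closed_connect clx (connect_root e x).
    by rewrite !inE eqxx => /esym/eqP.
  apply/forallP=> x; apply/forallP=> y; apply/implyP=> xy; rewrite !ffunE.
  apply/eqP; congr (g _); apply: val_inj => /=.
  by apply/(rootP csym)/connect1.
rewrite card_imset // cardsT card_ffun card_Fp // card_sig; congr (2 ^ _).
by apply: eq_card => x; rewrite !inE andbT.
Qed.

Lemma involutive2_sym (C : finType) (f g : C -> C) :
  involutive f -> involutive g ->
  symmetric [rel x y | has (fun k : C -> C => k x == y) [:: f; g]].
Proof.
by move=> fK gK x y /=; rewrite !orbF (inv_eq fK) (inv_eq gK) ![x == _]eq_sym.
Qed.

Lemma involutive3_sym (C : finType) (f g k : C -> C) :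
  involutive f -> involutive g -> involutive k ->
  symmetric [rel x y | has (fun l : C -> C => l x == y) [:: f; g; k]].
Proof.
move=> fK gK kK x y /=.
by rewrite !orbF (inv_eq fK) (inv_eq gK) (inv_eq kK) ![x == _]eq_sym.
Qed.

Lemma edge_corner (E : finType) (G : ribbonGraph E) e :
  exists x : corner G, edge_of x = e.
Proof.
have /card_gt0P[x] : 0 < #|[set x : corner G | edge_of x == e]|.
  by rewrite edge_card.
by rewrite inE => /eqP xe; exists x.
Qed.

(** * Kernels of principal submatrices *)

Section PrincipalSubmatrix.
Variables (F : fieldType) (n : nat) (S : {set 'I_n}).
Implicit Type M : 'M[F]_n.

Definition inclusion_mx : 'M[F]_(#|S|, n) := rowsub enum_val 1%:M%R.

Lemma mul_inclusion_tr m (u : 'M_(m, n)) i k :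
  (u *m inclusion_mx^T)%R i k = u i (enum_val k).
Proof. by rewrite trmx_mxsub trmx1 mulmx_colsub mulmx1 mxE. Qed.

Lemma principalE M : principal M S = (inclusion_mx *m M *m inclusion_mx^T)%R.
Proof. by apply/matrixP=> i j; rewrite mul_inclusion_tr -rowsubE !mxE. Qed.

Lemma inclusion_mxK : (inclusion_mx *m inclusion_mx^T = 1%:M)%R.
Proof.
by apply/matrixP=> i j; rewrite mul_inclusion_tr !mxE (inj_eq enum_val_inj).
Qed.

Lemma mul_inclusion_out m (u : 'M_(m, #|S|)) i k : k \notin S ->
  (u *m inclusion_mx)%R i k = 0%R.
Proof.
move=> kS; rewrite mxE big1 // => j _; rewrite !mxE.
by case: eqP kS => [<-|]; rewrite ?enum_valP ?mulr0.
Qed.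

Lemma principal_diag_ind : principal (diag_ind F S) S = 1%:M%R.
Proof.
by apply/matrixP=> i j; rewrite !mxE (inj_eq enum_val_inj) enum_valP.
Qed.

(* [M + I_S] fixes every kernel vector of [M[S]], up to entries outside [S]. *)
Lemma corank_principal_le M :
  corank (principal M S) <= \rank (M + diag_ind F S)%R.
Proof.
rewrite /corank -mxrank_ker; set K := kermx _.
have KE : (K *m principal (M + diag_ind F S) S = K)%R.
  rewrite principalE mulmxDr mulmxDl -!principalE principal_diag_ind.
  by rewrite mulmxDr mulmx_ker add0r mulmx1.
rewrite -{1}KE principalE !mulmxA (leq_trans (mxrankM_maxl _ _)) //.
exact: mxrankM_maxr.
Qed.

End PrincipalSubmatrix.

Definition supported_kernel n (M : 'M['F_2]_n) (S : {set 'I_n}) (v : 'rV_n) :=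
  [forall i, (if i \in S then v *m M else v)%R 0%R i == 0%R].

(** Extension by zero, [u *m P], maps the row kernel of [M[S]] bijectively onto these vectors;
    restriction to [S], [v *m P^T], is its inverse. *)
Lemma card_supported_kernel n (M : 'M['F_2]_n) (S : {set 'I_n}) :
  #|[set v | supported_kernel M S v]| = 2 ^ corank (principal M S).
Proof.
rewrite /corank -mxrank_ker -[X in X ^ _](@card_Fp 2) // -card_rowg.
set P := inclusion_mx 'F_2 S.
have Pinj : injective (fun u : 'rV_#|S| => u *m P)%R.
  move=> u w /(congr1 (mulmx^~ P^T)%R).
  by rewrite -!mulmxA inclusion_mxK !mulmx1.
rewrite -(card_imset _ Pinj).
apply: eq_card => v; rewrite inE; apply/forallP/imsetP => [vP | [u uK ->] i].
  have vE : (v *m P^T *m P = v)%R.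
    apply/rowP=> i; have [iS | iS] := boolP (i \in S); last first.
      rewrite mul_inclusion_out //; have := vP i.
      by rewrite (negPf iS) => /eqP->.
    rewrite -(enum_rankK_in iS iS) -!mul_inclusion_tr -/P.
    by rewrite -(mulmxA _ P) inclusion_mxK mulmx1.
  exists (v *m P^T)%R; last by rewrite vE.
  rewrite inE; apply/sub_kermxP; rewrite principalE !mulmxA vE.
  apply/rowP=> j; rewrite mul_inclusion_tr [RHS]mxE.
  by have := vP (enum_val j); rewrite enum_valP => /eqP.
move: uK; rewrite inE => /sub_kermxP; rewrite principalE !mulmxA => uK.
have [iS | iS] := boolP (i \in S); last by rewrite mul_inclusion_out.
by rewrite -(enum_rankK_in iS iS) -mul_inclusion_tr uK mxE.
Qed.

(** The two matrices have different index types, so their coranks are compared through the sizes of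
    the kernels. *)
Lemma corank_principalT n (M : 'M['F_2]_n) :
  corank (principal M setT) = n - \rank M.
Proof.
apply/eqP; rewrite -(eqn_exp2l _ _ (isT : 1 < 2)) -card_supported_kernel.
rewrite -mxrank_ker -[X in _ == X ^ _](@card_Fp 2) // -card_rowg; apply/eqP.
apply: eq_card => v; rewrite !inE; apply/forallP/sub_kermxP => [vP | v0 i].
  by apply/rowP=> i; have := vP i; rewrite inE => /eqP->; rewrite mxE.
by rewrite inE v0 mxE.
Qed.

(** * The walk around a single vertex *)

Section OneVertex.
Variables (E : finType) (B : ribbonGraph E).
Implicit Types (x y z : corner B) (e f : E) (h : corner B -> bool).

Notation seg := (@seg E B).
Notation side := (@side E B).
Notation arc := (@Defs.arc E B).
Notation next := (@next_end E B).
Notation walk x := (orbit next x).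

Hypothesis vertex_connected : forall (T : eqType) (h : corner B -> T),
  (forall x, h (seg x) = h x) -> (forall x, h (arc x) = h x) ->
  forall x y, h x = h y.

Lemma next_inj : injective next.
Proof. exact: inj_comp (inv_inj (@arcK E B)) (inv_inj (@segK E B)). Qed.

(** A walk from [x] to [seg x] could be shortened by one step at each end, to a walk from [next x]
    to [seg (next x)]. Lengths 0 and 1 contradict [seg_neq] and [arc_neq]. *)
Lemma iter_next_neq_seg k x : iter k next x != seg x.
Proof.
have [n] := ubnP k; elim: n k x => // n IHn [|[|k]] x /ltnSE le_kn.
- by rewrite eq_sym seg_neq.
- exact: arc_neq.
- apply: contra (IHn k (next x) (ltnW le_kn)) => /eqP eq_x.
  apply/eqP/next_inj; rewrite -iterS -iterSr eq_x.
  by rewrite /next_end segK arcK.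
Qed.

Lemma mem_walk_next x y : (next y \in walk x) = (y \in walk x).
Proof. by rewrite -!fconnect_orbit -same_fconnect1_r //; apply: next_inj. Qed.

(** The walk and its image under [seg] are disjoint by [iter_next_neq_seg]. Their union is closed
    under [seg] and [arc], hence contains every corner: these are the two directions around the
    vertex. *)
Lemma mem_walk_seg x y : (seg y \in walk x) = (y \notin walk x).
Proof.
have disj z : z \in walk x -> seg z \notin walk x.
  rewrite -!fconnect_orbit => xz; apply/negP => xsz.
  have: fconnect next z (seg z).
    by rewrite (connect_trans _ xsz) // fconnect_sym //; apply: next_inj.
  by move/iter_findex/eqP; apply/negP/iter_next_neq_seg.
pose h z := (z \in walk x) || (seg z \in walk x).
have: h y = h x.
  apply: vertex_connected => z; rewrite /h; first by rewrite segK orbC.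
  rewrite orbC; congr orb.
    by rewrite -[LHS]mem_walk_next /next_end segK arcK.
  by rewrite -[RHS]mem_walk_next /next_end segK.
rewrite /h in_orbit; case: (boolP (y \in _)) => [/disj/negPf|_ /=] //.
Qed.

Lemma mem_walk_arc x y : (arc y \in walk x) = (y \notin walk x).
Proof. by rewrite -{1}[y]segK mem_walk_next mem_walk_seg. Qed.

Lemma corners_of_edge x y : edge_of x = edge_of y ->
  [|| x == y, x == seg y, x == side y | x == seg (side y)].
Proof.
move=> exy; have side_seg : side y != seg y.
  by rewrite -(inj_eq (inv_inj (@segK _ B))) segK seg_side_neq.
have: x \in [set z | edge_of z == edge_of y] by rewrite inE exy.
suff <- : [set y; seg y; side y; seg (side y)]
    = [set z | edge_of z == edge_of y].
  by rewrite !inE -!orbA.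
apply/eqP; rewrite eqEcard edge_card; apply/andP; split.
  by apply/subsetP=> z; rewrite !inE -!orbA =>
    /or4P[] /eqP->; rewrite ?edge_seg ?edge_side ?edge_seg ?edge_side.
rewrite -!setUA !cardsU1 cards1 !inE.
rewrite (inj_eq (inv_inj (@segK _ B))) ![y == _]eq_sym ![_ == side y]eq_sym.
by rewrite !(negPf (seg_neq _)) !(negPf (side_neq _)) (negPf (seg_side_neq _))
  (negPf side_seg) eq_sym (negPf (seg_neq _)).
Qed.

(** [seg] exchanges the corners of [e] on the walk with those off it, so half of the four lie on
    it. *)
Lemma count_walk x e : count (fun y => edge_of y == e) (walk x) = 2.
Proof.
rewrite -size_filter; set s := filter _ _.
have s_uniq : uniq s by rewrite filter_uniq ?orbit_uniq.
rewrite -(card_uniqP s_uniq); apply/eqP; rewrite -(eqn_pmul2l (isT : 0 < 2)).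
rewrite -[X in _ == X](edge_card B e) -(cardsID [set y in walk x]) mul2n -addnn.
have -> : #|s| = #|[set y | edge_of y == e] :&: [set y in walk x]|.
  by apply: eq_card => y; rewrite !inE mem_filter.
rewrite eqn_add2l -(card_imset _ (inv_inj (@segK _ B))); apply/eqP.
apply: eq_card => y; rewrite !inE; apply/imsetP/andP => [[z + ->]|[yx ye]].
  by rewrite !inE edge_seg mem_walk_seg => /andP[-> ->].
exists (seg y); last by rewrite segK.
by rewrite !inE edge_seg mem_walk_seg ye.
Qed.

(** A colouring that alternates under [seg] and [arc] is constant along a walk; conversely,
    membership in the walk is such a colouring, and it changes across the sides of the ribbon iff
    [side x] is off the walk. *)
Lemma nonorientable_loopE x :
  nonorientable_loop B (edge_of x) = (side x \in walk x).
Proof.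
apply/idP/idP => [|xs]; last first.
  apply/existsP => -[s /forallP sP].
  have s_next y : s (next y) = s y.
    have /and3P[+ _ _] := sP y; have /and3P[_ + _] := sP (seg y).
    by rewrite /next_end; do 3!case: (s _).
  have /and3P[_ _] := sP x; rewrite eqxx /=; move: xs.
  rewrite -fconnect_orbit => /(@fconnect_invariant _ next _ s) -> //.
    by rewrite eqxx.
  by move=> y; rewrite /= s_next eqxx.
apply: contraR => xs; apply/existsP; exists [ffun y => y \in walk x].
apply/forallP=> y; rewrite !ffunE mem_walk_seg mem_walk_arc.
have negb_neq b : ~~ b != b by case: b.
rewrite !negb_neq /=; apply/implyP => /eqP/corners_of_edge.
case/or4P=> /eqP->; rewrite ?sideK -?seg_sideC ?sideK ?mem_walk_seg;
  by rewrite ?(negPf xs) ?in_orbit.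
Qed.

(** * Jump functions of a loop *)

(** The ends of [f] cut the vertex boundary into two intervals, and [h] tells these apart. *)
Definition jump_function f h :=
  (forall x, h (arc x) = h x) /\
  (forall x, h (seg x) = h x (+) (edge_of x == f)).

Lemma jump_next f h x : jump_function f h ->
  h (next x) = h x (+) (edge_of x == f).
Proof. by case=> h_arc h_seg; rewrite /next_end h_arc h_seg. Qed.

Lemma sorted_jump f h (p : pred (corner B)) x : jump_function f h ->
  (forall y, edge_of y == f -> p y) ->
  sorted (fun y z => h z == h y (+) (edge_of y == f)) (filter p (walk x)).
Proof.
move=> hf fp; rewrite /orbit; move: (order _ _) => n.
(* [seg (arc x)] precedes [x] on the walk. Put in front of the list, it starts an induction in which
   [y] is the last corner before [x] not skipped. *)
apply: (@path_sorted _ _ (seg (arc x))).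
have: h x = h (seg (arc x)) (+) (edge_of (seg (arc x)) == f).
  by rewrite -jump_next // /next_end segK arcK.
move: (seg _) => y; elim: n x y => //= n IHn x y hx; case: ifP => [px|px] /=.
  by rewrite {1}hx eqxx IHn // (jump_next x hf).
apply: IHn; rewrite (jump_next x hf) -hx.
by case: eqP px => [/eqP/fp->|_ _]; rewrite ?addbF.
Qed.

(** The two corners of [f] on a walk have opposite values. The one other than [x] is [side x] if the
    loop is non-orientable; otherwise it is [seg (side x)], and the jump across that segment
    restores the value. *)
Lemma jump_diag f h x : jump_function f h -> edge_of x = f ->
  h x (+) h (side x) = nonorientable_loop B f.
Proof.
move=> hf xf; rewrite -xf nonorientable_loopE.
have flip y : y \in walk x -> edge_of y = f -> x != y -> h y = ~~ h x.
  move=> xy yf; have := count_walk x f; rewrite -size_filter.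
  have := sorted_jump x hf (fun _ => id).
  have: x \in [seq z <- walk x | edge_of z == f].
    by rewrite mem_filter xf eqxx in_orbit.
  have: y \in [seq z <- walk x | edge_of z == f] by rewrite mem_filter yf eqxx.
  case: filter => [|z1 [|z2 [|]]] //; rewrite !inE /= andbT => yz xz hz _.
  case/orP: xz yz hz => /eqP<-; case/orP=> /eqP<-; rewrite ?eqxx //.
    by rewrite xf eqxx => /eqP-> _; case: (h x).
  by rewrite yf eqxx => /eqP-> _; case: (h y).
have [xs | xs] := boolP (side x \in walk x).
  by rewrite (flip (side x)) ?edge_side // 1?eq_sym ?side_neq //; case: (h x).
have /flip: seg (side x) \in walk x by rewrite mem_walk_seg.
rewrite edge_seg edge_side eq_sym seg_side_neq (hf.2 (side x)) edge_side xf.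
rewrite eqxx.
by move=> /(_ erefl erefl); case: (h x); case: (h _).
Qed.

(** The values at [y] and [z] differ iff exactly one of the two corners of [f] on the walk separates
    them, that is, iff the ends alternate. *)
Lemma jump_pair f h x e y z : jump_function f h -> e != f ->
  y \in walk x -> z \in walk x -> edge_of y = e -> edge_of z = e -> y != z ->
  h y (+) h z
  = (ends_word x e f == [:: e; f; e; f])
    || (ends_word x e f == [:: f; e; f; e]).
Proof.
move=> hf ef xy xz ye ze yz.
pose p (w : corner B) := edge_of w \in [:: e; f].
have fp w : edge_of w == f -> p w by rewrite /p !inE orbC => ->.
have -> : ends_word x e f = [seq edge_of w | w <- [seq w <- walk x | p w]].
  by rewrite /ends_word filter_map.
have := sorted_jump x hf fp.
have: y \in [seq w <- walk x | p w] by rewrite mem_filter /p ye !inE eqxx.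
have: z \in [seq w <- walk x | p w] by rewrite mem_filter /p ze !inE eqxx.
have: all p [seq w <- walk x | p w] by apply: filter_all.
have: count (fun w => edge_of w == f) [seq w <- walk x | p w] = 2.
  rewrite count_filter -[RHS](count_walk x f); apply: eq_count => w /=.
  by case: eqP => //= wf; apply: fp; rewrite wf.
have: count (fun w => edge_of w == e) [seq w <- walk x | p w] = 2.
  rewrite count_filter -[RHS](count_walk x e); apply: eq_count => w /=.
  by rewrite /p !inE; case: eqP.
have: size [seq w <- walk x | p w] = 4.
  have := count_predUI
    (fun w => edge_of w == e) (fun w => edge_of w == f) (walk x).
  rewrite !count_walk size_filter (@eq_count _ (predI _ _) pred0) => [|w /=].
    rewrite count_pred0 addn0 => /(etrans _); apply; apply: eq_count => w.
    by rewrite /p !inE.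
  by apply/andP=> -[/eqP we]; rewrite we (negPf ef).
have nef : e <> f by apply/eqP.
case: filter => [|a [|b [|c [|d [|]]]]] //= _ + +.
have pE w : p w -> edge_of w = e \/ edge_of w = f.
  by rewrite /p !inE => /orP[]/eqP; [left | right].
move=> + + /and5P[/pE pa /pE pb /pE pc /pE pd _].
(* The counts leave the six arrangements of two [e] and two [f]; in each, [sorted] expresses the
   values at [b], [c], [d] through [h a]. *)
case: pa => Ea; case: pb => Eb; case: pc => Ec; case: pd => Ed;
  rewrite Ea Eb Ec Ed ?eqxx ?(negPf ef) ?[f == e]eq_sym ?(negPf ef) // => _ _;
  rewrite !inE => /or4P[]/eqP zE /or4P[]/eqP yE; subst y z; try congruence;
  rewrite ?eqxx // in yz *; case/and4P=> /eqP hb /eqP hc /eqP hd _;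
  rewrite ?hd ?hc ?hb ?eqseq_cons ?eqxx ?(negPf ef) ?[f == e]eq_sym ?(negPf ef);
  by case: (h a).
Qed.

(** Whether the ends alternate does not depend on the start [x'] of the walk. A corner of [e] off
    the walk is replaced by its image under [seg], where [h] has the same value because [e] is not
    [f]. *)
Lemma jump_interlaced f h x : jump_function f h -> edge_of x != f ->
  h x (+) h (side x) = interlaced B (edge_of x) f.
Proof.
move=> hf xf; rewrite /interlaced xf /=.
set e := edge_of x in xf *.
pose word x' :=
  (ends_word x' e f == [:: e; f; e; f])
  || (ends_word x' e f == [:: f; e; f; e]).
have wordE x' : h x (+) h (side x) = word x'.
  have h_seg y : edge_of y = edge_of x -> h (seg y) = h y.
    by rewrite hf.2 => ->; rewrite (negPf xf) addbF.
  have cross y : y \in walk x' -> edge_of y = edge_of x ->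
      h y (+) h (side y) = word x'.
    move=> yx' ye.
    have [ys | ys] := boolP (side y \in walk x').
      by apply: (jump_pair hf xf) => //; rewrite ?edge_side // eq_sym side_neq.
    rewrite -(h_seg (side y)) ?edge_side //; apply: (jump_pair hf xf) => //.
    - by rewrite mem_walk_seg.
    - by rewrite edge_seg edge_side.
    - by rewrite eq_sym seg_side_neq.
  have [xx' | xx'] := boolP (x \in walk x'); first exact: cross.
  rewrite -(h_seg x) // -(h_seg (side x)) ?edge_side // seg_sideC.
  by apply: cross; rewrite ?mem_walk_seg ?edge_seg.
by apply/idP/existsP => [hx | [x']]; [exists x|]; rewrite -/(word _) -wordE.
Qed.

(** Count the corners of [f] passed along one walk, modulo 2. This closes up since the walk meets
    [f] twice; off the walk the jump across [seg] dictates the value. *)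
Lemma jump_function_exists f : exists h, jump_function f h.
Proof.
have [x _] := edge_corner B f.
pose c i := odd (count (fun y => edge_of y == f) (traject next x i)).
have cS i : c i.+1 = c i (+) (edge_of (iter i next x) == f).
  by rewrite /c trajectSr -cats1 count_cat oddD /= addn0 oddb.
pose k y := c (findex next x y).
have k_next y : y \in walk x -> k (next y) = k y (+) (edge_of y == f).
  rewrite -fconnect_orbit => xy; rewrite -{1 3}(iter_findex xy) -cS /k -iterS.
  have := findex_max xy; rewrite leq_eqVlt => /predU1P[->|lt_k].
    by rewrite iter_order ?findex0 /c; [rewrite count_walk | apply: next_inj].
  by rewrite findex_iter.
exists (fun y => if y \in walk x then k y else k (seg y) (+) (edge_of y == f)).
split=> y.
  rewrite mem_walk_arc; have [yx | yx] /= := boolP (y \in walk x).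
    rewrite -(edge_seg (arc y)) -k_next ?mem_walk_seg ?mem_walk_arc ?yx //.
    by rewrite /next_end segK arcK.
  by rewrite -(edge_seg y) -k_next ?mem_walk_seg // /next_end segK.
rewrite mem_walk_seg edge_seg segK; case: (y \in walk x) => //=.
by rewrite -addbA addbb addbF.
Qed.
Notation M := (graft_mx (intersection_graft B)).

Lemma jump_matrix h i x : jump_function (enum_val i) h ->
  ((h x)%:R + (h (side x))%:R = M (enum_rank (edge_of x)) i :> 'F_2)%R.
Proof.
move=> hi; rewrite -F2_natr_addb !mxE enum_rankK /=.
rewrite -(inj_eq enum_val_inj) enum_rankK inE.
case: eqVneq => [xi | xi] /=; first by rewrite xi (jump_diag hi).
by rewrite orbF (jump_interlaced hi).
Qed.

(** * Boundary components and the kernel *)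

Section Boundary.
Variables (S T : {set 'I_#|E|}) (bd : corner B -> corner B).
Hypothesis (bdK : involutive bd) (sTS : T \subset S).
Notation rk x := (enum_rank (edge_of x)).
Hypothesis bdE : forall x,
  bd x = if rk x \in T then seg (side x)
         else if rk x \in S then side x else seg x.

(** [Phi] sends a constant and a vector of jumps to a function; it maps the pairs with vector in the
    supported kernel bijectively onto the invariant functions. The constant accounts for the
    successor and is read off at [x0]. *)
Lemma card_boundary x0 :
  2 ^ orbit_count [:: bd; arc]
  = 2 ^ (corank (principal (M + diag_ind _ T)%R S)).+1.
Proof.
have [H HP] : exists H : 'I_#|E| -> corner B -> bool,
    forall i, jump_function (enum_val i) (H i).
  by apply: (fin_all_exists (fun i => jump_function_exists (enum_val i))).
have [end_of endP] : exists u : 'I_#|E| -> corner B, forall i, rk (u i) = i.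
  apply: (fin_all_exists (P := fun i y => rk y = i)) => i.
  by have [y yi] := edge_corner B (enum_val i); exists y; rewrite yi enum_valK.
pose Phi (a : 'F_2 * 'rV['F_2]_#|E|) : {ffun corner B -> 'F_2} :=
  [ffun x => a.1 + \sum_i a.2 0 i * (H i x)%:R]%R.
have Phi_arc a x : Phi a (arc x) = Phi a x.
  by rewrite !ffunE; under eq_bigr do rewrite (HP _).1.
have Phi_seg a x : (Phi a (seg x) = Phi a x + a.2 0 (rk x))%R.
  rewrite !ffunE -addrA; congr +%R.
  under eq_bigr do rewrite (HP _).2 F2_natr_addb mulrDr.
  rewrite big_split /=; congr +%R.
  rewrite (bigD1 (rk x)) //= enum_rankK eqxx mulr1.
  rewrite big1 ?addr0 // => i; rewrite -(inj_eq enum_val_inj) enum_rankK eq_sym.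
  by move=> /negPf->; rewrite mulr0.
have Phi_side a x : (Phi a (side x) = Phi a x + (a.2 *m M) 0 (rk x))%R.
  rewrite -[LHS](F2_addKr (Phi a x)); congr +%R.
  rewrite !ffunE addrACA F2_addrr add0r -big_split mxE; apply: eq_bigr => i _.
  by rewrite /= -mulrDr (jump_matrix x (HP i)) -graft_mx_sym mxE graft_mx_sym.
(* On a twisted ribbon [bd] also crosses a segment of the edge, which adds the diagonal entry of
   [I_T]. *)
have Phi_bd a x : (Phi a (bd x) == Phi a x) =
    ((if rk x \in S then a.2 *m (M + diag_ind _ T) else a.2)%R 0%R (rk x)
     == 0%R).
  have addr_id (u v : 'F_2) : (u + v == u)%R = (v == 0%R).
    by rewrite -subr_eq0 addrC addKr.
  have mulE j : ((a.2 *m (M + diag_ind _ T)) 0 j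
      = (a.2 *m M) 0 j + a.2 0 j * (j \in T)%:R)%R.
    by rewrite mulmxDr mxE mul_mx_diag [X in (_ + X)%R]mxE [X in (_ * X)%R]mxE.
  rewrite bdE; have [xT | xT] := boolP (rk x \in T).
    rewrite (subsetP sTS _ xT) Phi_seg edge_side Phi_side -addrA addr_id.
    by rewrite mulE xT mulr1.
  case: ifP => _; last by rewrite Phi_seg addr_id.
  by rewrite Phi_side addr_id mulE (negPf xT) mulr0 addr0.
have Phi_inj : injective Phi.
  move=> [a u] [b v] eqP; have uv : u = v.
    apply/rowP=> i; rewrite -(endP i).
    apply: (addrI (Phi (a, u) (end_of i))).
    by rewrite -(Phi_seg (a, u)) eqP (Phi_seg (b, v)).
  have := congr1 (fun g : {ffun _} => g x0) eqP.
  by rewrite !ffunE uv /= => /addIr->.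
rewrite -(card_component_functions (involutive2_sym bdK (@arcK E B))) expnS.
rewrite -card_supported_kernel -[X in (X * _)%N](@card_Fp 2) // -(cardsT 'F_2).
rewrite -cardsX -(card_imset _ Phi_inj).
apply: eq_card => h; rewrite inE; apply/idP/imsetP=> [hP | [a]]; last first.
  rewrite !inE /= => /forallP aP ->; apply/forallP=> x; apply/forallP=> y.
  apply/implyP=> /or3P[] // /eqP<-; last by rewrite Phi_arc.
  by rewrite eq_sym Phi_bd; apply: aP.
have h_bd x : h (bd x) = h x.
  apply/esym/eqP; have /forallP/(_ x)/forallP/(_ (bd x)) := hP.
  by rewrite /= eqxx.
have h_arc x : h (arc x) = h x.
  apply/esym/eqP; have /forallP/(_ x)/forallP/(_ (arc x)) := hP.
  by rewrite /= eqxx orbT.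
pose a : 'rV['F_2]_#|E| := (\row_i (h (end_of i) + h (seg (end_of i))))%R.
have h_seg x : (h (seg x) = h x + a 0 (rk x))%R.
  rewrite mxE; set y := end_of _.
  have xy : edge_of x = edge_of y by apply: enum_rank_inj; rewrite endP.
  apply/(addrI (h x)); rewrite addrA F2_addrr add0r.
  (* The two ends of an edge have the same jump: on a kept ribbon [bd] carries one end to the other,
     and on a deleted one both jumps vanish. *)
  have h_ends : (h (side y) + h (seg (side y)) = h y + h (seg y))%R.
    have := bdE (side y); have := bdE (seg y); have := bdE y.
    rewrite edge_seg edge_side; case: ifP => _; last case: ifP => _.
    - rewrite seg_sideC -seg_sideC segK => E1 E2 _.
      by rewrite -[in LHS]E1 -E2 !h_bd addrC.
    - by rewrite seg_sideC => <- <- _; rewrite !h_bd.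
    - by move=> <- _ <-; rewrite !h_bd !F2_addrr.
  case/or4P: (corners_of_edge xy) => /eqP->; rewrite ?segK //.
  - by rewrite addrC.
  - by rewrite addrC.
(* In characteristic 2 this is the difference of two functions with equal jumps, hence constant. *)
pose g x := (h x + Phi (0, a) x)%R.
have g_const x : g x = g x0.
  apply: vertex_connected => z; rewrite /g ?h_arc ?Phi_arc // h_seg Phi_seg /=.
  by rewrite addrACA F2_addrr addr0.
have hE : h = Phi (g x0, a).
  apply/ffunP=> x; rewrite [RHS]ffunE /= -(g_const x) /g [Phi _ _]ffunE /=.
  by rewrite add0r -addrA F2_addrr addr0.
exists (g x0, a) => //; rewrite !inE /=; apply/forallP=> i.
by rewrite -(endP i) -(Phi_bd (g x0, a)) -hE h_bd.
Qed.

End Boundary.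
End OneVertex.

(** * Vertex, face and component counts for a bouquet *)

Lemma bouquet_vertex_connected (E : finType) (B : ribbonGraph E) :
  bouquet B -> forall (T : eqType) (h : corner B -> T),
  (forall x, h (seg x) = h x) -> (forall x, h (Defs.arc x) = h x) ->
  forall x y, h x = h y.
Proof.
rewrite /bouquet /num_vertices /orbit_count => B1 T h h_seg h_arc.
set r := [rel x y | _] in B1.
have r_sym : connect_sym r.
  exact: sym_connect_sym (involutive2_sym (@segK E B) (@arcK E B)).
have h_root x : h (root r x) = h x.
  have cl : closed r [pred y | h y == h x].
    by move=> y z /or3P[] // /eqP<-; rewrite !inE ?h_seg ?h_arc.
  by apply/eqP; have := closed_connect cl (connect_root r x); rewrite !inE eqxx.
have /card_le1_eqP root1 : #|predI (roots r) (corner B)| <= 1.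
  by apply: leq_trans (leq_addr (isolated B) _) _; rewrite B1.
move=> x y; rewrite -h_root -(h_root y); congr h.
by apply: root1; rewrite !inE andbT roots_root.
Qed.

Section BouquetCounts.
Variables (E : finType) (B : ribbonGraph E).
Hypothesis B_bouquet : bouquet B.
Notation M := (graft_mx (intersection_graft B)).

Lemma orbit_count_empty (fs : seq (corner B -> corner B)) : #|E| = 0 ->
  orbit_count fs = 0.
Proof.
by move=> E0; apply: eq_card0 => x; have := fintype0 (edge_of x) E0.
Qed.

(** In the edgeless case there are no corners, and the isolated vertex supplies the only boundary
    component and the only connected component. *)
Lemma bouquet_isolated : isolated B = (#|E| == 0).
Proof.
case: eqP => [E0 | /eqP].
  by move: B_bouquet; rewrite /bouquet /num_vertices orbit_count_empty.
rewrite -lt0n => /card_gt0P[e _]; have [x _] := edge_corner B e.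
move: B_bouquet; rewrite /bouquet /num_vertices.
have : 0 < orbit_count [:: @seg E B; @Defs.arc E B].
  rewrite /orbit_count; set r := [rel x y | _].
  have r_sym : connect_sym r.
    exact: sym_connect_sym (involutive2_sym (@segK E B) (@arcK E B)).
  by apply/card_gt0P; exists (root r x); rewrite !inE roots_root.
by case: orbit_count => // k _ [] /eqP; rewrite addn_eq0 => /andP[_ /eqP].
Qed.

Lemma boundary_count (S T : {set 'I_#|E|}) (bd : corner B -> corner B) :
  involutive bd -> T \subset S ->
  (forall x, bd x = if enum_rank (edge_of x) \in T then seg (side x)
                    else if enum_rank (edge_of x) \in S then side x
                    else seg x) ->
  orbit_count [:: bd; @Defs.arc E B] + isolated B
  = (corank (principal (M + diag_ind _ T)%R S)).+1.
Proof.
move=> bdK sTS bdE; rewrite bouquet_isolated; case: eqP => [E0 | /eqP].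
  have S0 : #|S| = 0.
    by apply/eqP; rewrite -leqn0 -E0 -[X in _ <= X]card_ord max_card.
  by rewrite orbit_count_empty //; congr _.+1; apply/esym/eqP;
    rewrite -leqn0 -[X in _ <= X]S0 leq_subr.
rewrite -lt0n => /card_gt0P[e _]; have [x _] := edge_corner B e.
rewrite addn0; apply/eqP; rewrite -(eqn_exp2l _ _ (isT : 1 < 2)).
by rewrite (card_boundary (bouquet_vertex_connected B_bouquet) bdK sTS bdE x).
Qed.

(** With [f] and [g] the new [seg] and [side], the old [seg] is still a composite of moves, so each
    component contains a whole old vertex, of which there is only one. *)
Lemma component_count (f g : corner B -> corner B) :
  involutive f -> involutive g ->
  (forall x, [|| seg x == f x, seg x == g x | seg x == f (g x)]) ->
  orbit_count [:: f; g; @Defs.arc E B] + isolated B = 1.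
Proof.
move=> fK gK fg_seg; rewrite bouquet_isolated; case: eqP => [E0 | /eqP].
  by rewrite orbit_count_empty.
rewrite -lt0n => /card_gt0P[e _]; have [x _] := edge_corner B e.
rewrite addn0 /orbit_count; set r := [rel x y | _].
have r_sym : connect_sym r.
  exact: sym_connect_sym (involutive3_sym fK gK (@arcK E B)).
have stepf y : connect r y (f y) by apply: connect1; rewrite /r /= eqxx.
have stepg y : connect r y (g y) by apply: connect1; rewrite /r /= eqxx orbT.
have step y z w : connect r y z -> connect r w y = connect r w z.
  by move=> yz; rewrite !(r_sym w); apply: same_connect r_sym _ _ yz w.
rewrite -(n_comp_connect r_sym x); apply: eq_n_comp_r => y; rewrite !inE.
rewrite -[RHS](@bouquet_vertex_connected _ _ B_bouquet _ (connect r x) _ _ x).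
- by rewrite connect0.
- move=> z; apply/esym/step; case/or3P: (fg_seg z) => /eqP-> //.
  exact: connect_trans (stepg z) (stepf _).
- by move=> z; apply/esym/step/connect1; rewrite /r /= eqxx !orbT.
Qed.

End BouquetCounts.

(** * The Euler genus for the five words *)

Lemma absz_connected_genus (E : finType) (G : ribbonGraph E) v f :
  num_components G = 1 -> num_vertices G = v.+1 -> num_faces G = f.+1 ->
  `|euler_genus G|%N = `|(#|E|%:Z - v%:Z - f%:Z)%R|%N.
Proof. by rewrite /euler_genus /num_edges => -> -> ->; lia. Qed.

(** For words starting with [Delta]: vertices and faces give coranks on complementary sets. *)
Lemma absz_sub_coranks (n a b r s : nat) : a + b = n -> r <= a -> s <= b ->
  `|(n%:Z - (a - r)%N%:Z - (b - s)%N%:Z)%R|%N = r + s.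
Proof. by lia. Qed.

(** For words starting with [Tau]: the faces give a corank on the whole edge set. *)
Lemma absz_sub_corank (n c r : nat) : c <= r -> r <= n ->
  `|(n%:Z - c%:Z - (n - r)%N%:Z)%R|%N = r - c.
Proof. by lia. Qed.


Lemma side_tau_delta (E : finType) (B : ribbonGraph E) (A : {set E})
    (x : corner B) :
  @petrial_side E A (partial_dual A B) x
  = if edge_of x \in A then seg (side x) else side x.
Proof.
rewrite /petrial_side /partial_dual /= dual_seg_sideC /dual_side /dual_seg.
by case xA: (edge_of x \in A); rewrite ?edge_side ?xA ?seg_sideC.
Qed.

(** On [A] the first twist turns [side] into [seg \o side]; composing with [seg] again undoes it. *)
Lemma side_tau_delta_tau (E : finType) (B : ribbonGraph E) (A : {set E})
    (x : corner B) :
  @petrial_side E A (partial_dual A (partial_petrial A B)) x = side x.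
Proof.
rewrite (@side_tau_delta E (partial_petrial A B)) /partial_petrial /=.
by rewrite /petrial_side; case: (edge_of x \in A); rewrite ?segK.
Qed.

Theorem theorem2p13 :
  forall (E : finType) (B : ribbonGraph E), bouquet B ->
  forall b : bullet,
    partial_poly b B = graft_poly b (intersection_graft B).
Proof.
move=> E B B_bouquet b; rewrite /partial_poly /graft_poly /rank_poly.
pose ind (A : {set E}) : {set 'I_#|E|} := [set i | enum_val i \in A].
have ind_bij : bijective ind.
  exists (fun A : {set 'I_#|E|} => [set e | enum_rank e \in A]) => A.
    by apply/setP=> e; rewrite !inE enum_rankK.
  by apply/setP=> i; rewrite !inE enum_valK.
rewrite (reindex ind) /=; last exact: onW_bij.
apply: eq_bigr => A _; congr (_ ^+ _)%R.
have indE (x : corner B) :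
    (enum_rank (edge_of x) \in ind A) = (edge_of x \in A).
  by rewrite inE enum_rankK.
set M := graft_mx _.
have cardA : #|ind A| + #|~: ind A| = #|E| by rewrite cardsC card_ord.
have rank_le S (N : 'M['F_2]_#|E|) : \rank (principal N S) <= #|S|.
  exact: rank_leq_row.
have corank0 (N : 'M['F_2]_#|E|) : corank (principal N set0) = 0.
  by apply/eqP; rewrite -leqn0 (leq_trans (leq_subr _ _)) // cards0.
have diag0 : diag_ind _ set0 = 0%R :> 'M['F_2]_#|E|.
  by apply/matrixP=> i j; rewrite !mxE inE mul0rn.
have := corank_principal_le (ind A) M.
(* Adding [I_A] twice returns [M], so this bounds the corank of [(M + I_A)[A]] by [\rank M]. Both
   bounds make the truncated subtractions in [rank_fun] exact. *)
have := corank_principal_le (ind A) (M + diag_ind _ (ind A))%R.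
rewrite -addrA (_ : diag_ind _ _ + diag_ind _ _ = 0)%R; last first.
  by apply/matrixP=> i j; rewrite mxE F2_addrr mxE.
rewrite addr0.
have := rank_le (ind A) M; have := rank_le (~: ind A) M.
have := rank_le (ind A) (M + diag_ind _ (ind A))%R.
have := rank_leq_row M; have := rank_leq_row (M + diag_ind _ (ind A))%R.
(* [countS] counts vertices and [countF] faces; in each case their arguments are the sets of kept
   and of twisted ribbons that describe the new [seg] and [side]. *)
case: b => r1 r2 r3 r4 r5 r6 r7; set G := apply_word _ _ _;
  have segGK := @segK E G; have sideGK := @sideK E G;
  have countS S T := @boundary_count E B B_bouquet S T _ segGK;
  have countF S T := @boundary_count E B B_bouquet S T _ sideGK;
  have countC := @component_count E B B_bouquet _ _ segGK sideGK.
- have cG : num_components G = 1.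
    apply: countC => x; rewrite /= /dual_seg /dual_side.
    by case: ifP; rewrite eqxx ?orbT.
  rewrite (absz_connected_genus cG (countS (ind A) set0 _ _)
    (countF (~: ind A) set0 _ _)) ?sub0set //.
  + by rewrite -/M diag0 addr0; apply: absz_sub_coranks.
  + by move=> x; rewrite /= /dual_seg indE in_set0.
  + move=> x; rewrite /= /dual_side in_setC in_set0 indE.
    by case: (edge_of x \in A).
- have cG : num_components G = 1 by apply: countC => x; rewrite eqxx.
  rewrite (absz_connected_genus cG (countS set0 set0 _ _)
    (countF setT (ind A) _ _)) ?sub0set ?subsetT //.
  + by rewrite corank0 corank_principalT absz_sub_corank ?subn0.
  + by move=> x; rewrite !inE.
  + by move=> x; rewrite /= /petrial_side in_setT indE.
- have cG : num_components G = 1.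
    apply: countC => x; rewrite /= /dual_seg /dual_side /=.
    by case: ifP; rewrite eqxx ?orbT.
  rewrite (absz_connected_genus cG (countS (ind A) (ind A) _ _)
    (countF (~: ind A) set0 _ _)) ?sub0set //.
  + by rewrite -/M diag0 addr0; apply: absz_sub_coranks.
  + move=> x; rewrite /= /dual_seg /= /petrial_side indE.
    by case: (edge_of x \in A).
  + move=> x; rewrite /= /dual_side /= /petrial_side in_setC in_set0 indE.
    by case: (edge_of x \in A).
- have segE (x : corner B) :
      @seg E G x = if edge_of x \in A then side x else seg x by [].
  have sideE (x : corner B) :
      @side E G x = if edge_of x \in A then seg (side x) else side x.
    exact: side_tau_delta.
  have cG : num_components G = 1.
    apply: countC => x; rewrite !segE !sideE.
    case xA: (edge_of x \in A); last by rewrite eqxx.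
    by rewrite edge_seg edge_side xA seg_sideC sideK eqxx !orbT.
  rewrite (absz_connected_genus cG (countS (ind A) set0 _ _)
    (countF setT (ind A) _ _)) ?sub0set ?subsetT //.
  + by rewrite -/M diag0 addr0 corank_principalT absz_sub_corank.
  + by move=> x; rewrite segE indE in_set0.
  + by move=> x; rewrite sideE in_setT indE.
- have segE (x : corner B) :
      @seg E G x = if edge_of x \in A then seg (side x) else seg x.
    by rewrite /= /dual_seg /= /petrial_side; case: (edge_of x \in A).
  have sideE (x : corner B) : @side E G x = side x by exact: side_tau_delta_tau.
  have cG : num_components G = 1.
    apply: countC => x; rewrite !segE !sideE.
    case xA: (edge_of x \in A); last by rewrite eqxx.
    by rewrite edge_side xA sideK eqxx !orbT.
  rewrite (absz_connected_genus cG (countS (ind A) (ind A) _ _)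
    (countF setT set0 _ _)) ?sub0set //.
  + by rewrite -/M diag0 addr0 corank_principalT absz_sub_corank.
  + by move=> x; rewrite segE indE; case: ifP.
  + by move=> x; rewrite sideE in_set0 in_setT.
Qed.
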